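(* Let $\mathbb{F}=(\mathbb{P},R_\Box,R_\Diamond)$ be an enriched formal context with $\mathbb{P}=(G,M,I)$, and let $V$ be a valuation into the concept lattice $\mathbb{P}^+$. Then for every formula $\varphi\in\mathcal{L}_N$ and every $g\in G$ (resp. $m\in M$): $V,g\Vdash\varphi$ (resp. $V,m\not\succ\varphi$) if and only if $\exists$ has a winning strategy in the evaluation game for the non-distributive modal $\mu$-calculus on $\mathbb{F}$ (with valuation $V$) starting from $(g,\varphi)$ (resp. $(m,\varphi)$).
   Context: Language $\mathcal{L}_N$: with $\mathrm{P}$ a countable set of atoms and $X$, $Y$ disjoint sets of variables, $\varphi::=p\mid x\mid y\mid\bot\mid\top\mid\varphi\vee\varphi\mid\varphi\wedge\varphi\mid\Box\varphi\mid\Diamond\varphi\mid\mu y.\varphi\mid\nu x.\varphi$ ($p\in\mathrm{P}$, $x\in X$, $y\in Y$); variables in $X$ are only bound by $\nu$, those in $Y$ only by $\mu$. Formulas are assumed renamed so that no variable occurs both free and bound and every bound variable is bound by exactly one fixed-point operator; for a bound variable $z$ let $\psi_z$ be the unique formula with $\eta z.\psi_z$ a subformula ($\eta\in\{\mu,\nu\}$). Dependency order on bound variables of $\varphi$: $z_1\le_\varphi z_2$ iff $z_2$ occurs free in $\psi_{z_1}$. Polarities and semantics: a polarity is $\mathbb{P}=(G,M,I)$, $I\subseteq G\times M$. For $T\subseteq U\times W$: $T^{(1)}[U']=\{w\mid\forall u\in U'\,uTw\}$, $T^{(0)}[W']=\{u\mid\forall w\in W'\,uTw\}$. $B^\uparrow=I^{(1)}[B]$,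 $Y^\downarrow=I^{(0)}[Y]$. A concept is $c=(B,Y)$ with $B=Y^\downarrow$, $Y=B^\uparrow$; $[\![c]\!]=B$, $(\![c]\!)=Y$; ordered by inclusion of extensions they form the complete lattice $\mathbb{P}^+$. $R_\Box\subseteq G\times M$, $R_\Diamond\subseteq M\times G$ are $I$-compatible: $R_\Box^{(0)}[m],R_\Box^{(1)}[g],R_\Diamond^{(0)}[g],R_\Diamond^{(1)}[m]$ are Galois-stable (closed under $(\cdot)^{\uparrow\downarrow}$ resp. $(\cdot)^{\downarrow\uparrow}$). $[R_\Box]c=(R_\Box^{(0)}[(\![c]\!)],I^{(1)}[R_\Box^{(0)}[(\![c]\!)]])$, $\langle R_\Diamond\rangle c=(I^{(0)}[R_\Diamond^{(0)}[[\![c]\!]]],R_\Diamond^{(0)}[[\![c]\!]])$. A valuation assigns concepts to atoms and to free variables and is extended to formulas by interpreting $\top,\bot,\wedge,\vee$ as top, bottom, meet, join of $\mathbb{P}^+$, $\Box$ as $[R_\Box]$, $\Diamond$ as $\langle R_\Diamond\rangle$, $\mu y.\varphi$ as the least fixed point and $\nu x.\varphi$ as the greatest fixed point of the monotone map $c\mapsto$ (value of $\varphi$ with $y$ resp. $x$ assigned $c$). $V,g\Vdash\varphi$ iff $g\in[\![V(\varphi)]\!]$; $V,m\succ\varphi$ iff $m\in(\![V(\varphi)]\!)$. Game: players $\exists,\forall$; $I^c,R_\Box^c,R_\Diamond^c$ denote complements of the relations. Positions $(g,\varphi)$, $(m,\varphi)$; owners and admissible moves: $(g,p)$ with $V,g\Vdash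 p$: $\forall$, none; $(g,p)$ with $V,g\not\Vdash p$: $\forall$, $\{(m,p)\mid gI^cm\}$; $(m,p)$ with $V,m\succ p$: $\exists$, none; $(m,p)$ with $V,m\not\succ p$: $\exists$, $\{(g,p)\mid gI^cm\}$ (free variables are handled like atoms); $(g,\top)$: $\forall$, none; $(m,\bot)$: $\exists$, none; $(g,\bot)$: $\forall$, $\{(m,\bot)\mid gI^cm\}$; $(m,\top)$: $\exists$, $\{(g,\top)\mid gI^cm\}$; $(m,\varphi_1\vee\varphi_2)$: $\exists$, $\{(m,\varphi_1),(m,\varphi_2)\}$; $(g,\varphi_1\vee\varphi_2)$: $\forall$, $\{(m,\varphi_1\vee\varphi_2)\mid gI^cm\}$; $(g,\varphi_1\wedge\varphi_2)$: $\forall$, $\{(g,\varphi_1),(g,\varphi_2)\}$; $(m,\varphi_1\wedge\varphi_2)$: $\exists$, $\{(g,\varphi_1\wedge\varphi_2)\mid gI^cm\}$; $(m,\Diamond\varphi)$: $\exists$, $\{(g,\varphi)\mid mR_\Diamond^cg\}$; $(g,\Diamond\varphi)$: $\forall$, $\{(m,\Diamond\varphi)\mid gI^cm\}$; $(g,\Box\varphi)$: $\forall$, $\{(m,\varphi)\mid gR_\Box^cm\}$; $(m,\Box\varphi)$: $\exists$, $\{(g,\Box\varphi)\mid gI^cm\}$; for bound $x\in X$: $(g,\nu x.\varphi_x)\to(g,\varphi_x)$ and $(g,x)\to(g,\nu x.\varphi_x)$ (forced, no player choice); $(m,\nu x.\varphi_x)$: $\exists$, $\{(g,\nu x.\varphi_x)\mid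 gI^cm\}$; $(m,x)$: $\exists$, $\{(g,x)\mid gI^cm\}$; for bound $y\in Y$: $(m,\mu y.\varphi_y)\to(m,\varphi_y)$ and $(m,y)\to(m,\mu y.\varphi_y)$ (forced); $(g,\mu y.\varphi_y)$: $\forall$, $\{(m,\mu y.\varphi_y)\mid gI^cm\}$; $(g,y)$: $\forall$, $\{(m,y)\mid gI^cm\}$. Winning: a player who must move but has none loses; in an infinite play, if the $\le_\varphi$-maximal bound variable occurring infinitely often (as second component of positions) is a $\nu$-variable then $\exists$ wins, and if it is a $\mu$-variable then $\forall$ wins. Strategies and winning strategies are defined as usual. *)

(* Defs.v *)
From HB Require Import structures.
From mathcomp Require Import all_boot all_order.
From mathcomp Require Import boolp classical_sets.

Set Implicit Arguments.
Unset Strict Implicit.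
Unset Printing Implicit Defensive.

Local Open Scope classical_set_scope.

Section Polar.
Context {U W : Type} (T : U -> W -> Prop).

(* T^(1)[A] and T^(0)[B] *)
Definition polar1 (A : set U) : set W := [set w | forall u, A u -> T u w].
Definition polar0 (B : set W) : set U := [set u | forall w, B w -> T u w].

End Polar.

Record polarity := Polarity {
  obj : Type;
  feat : Type;
  inc : obj -> feat -> Prop }.

Section Galois.
Context {P : polarity}.

Definition up (A : set (obj P)) : set (feat P) := polar1 (@inc P) A.
Definition down (B : set (feat P)) : set (obj P) := polar0 (@inc P) B.

Definition stable_obj (A : set (obj P)) : Prop := down (up A) = A.
Definition stable_feat (B : set (feat P)) : Prop := up (down B) = B.

Lemma upS (A A' : set (obj P)) : A `<=` A' -> up A' `<=` up A.
Proof. by move=> sA m H g /sA; apply: H. Qed.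

Lemma downS (B B' : set (feat P)) : B `<=` B' -> down B' `<=` down B.
Proof. by move=> sB g H m /sB; apply: H. Qed.

Lemma sub_down_up (A : set (obj P)) : A `<=` down (up A).
Proof. by move=> g Ag m; apply. Qed.

Lemma sub_up_down (B : set (feat P)) : B `<=` up (down B).
Proof. by move=> m Bm g; apply. Qed.

Lemma up_down_up (A : set (obj P)) : up (down (up A)) = up A.
Proof. by apply/seteqP; split; [apply/upS/sub_down_up | apply: sub_up_down]. Qed.

Lemma down_up_down (B : set (feat P)) : down (up (down B)) = down B.
Proof. by apply/seteqP; split; [apply/downS/sub_up_down | apply: sub_down_up]. Qed.

End Galois.

Record concept (P : polarity) := Concept {
  extent : set (obj P);
  intent : set (feat P);
  extentE : extent = down intent;
  intentE : intent = up extent }.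

HB.instance Definition _ (P : polarity) := gen_eqMixin (concept P).
HB.instance Definition _ (P : polarity) := gen_choiceMixin (concept P).

Section ConceptLattice.
Context {P : polarity}.
Implicit Types c d e : concept P.

Lemma concept_inj c d : extent c = extent d -> c = d.
Proof.
case: c d => [A B AE BE] [A' B' AE' BE'] /= EA.
have EB : B = B' by rewrite BE BE' EA.
move: AE' BE'; rewrite -EA -EB => AE' BE'.
by rewrite (Prop_irrelevance AE' AE) (Prop_irrelevance BE' BE).
Qed.

Definition concept_of_obj (A : set (obj P)) (sA : stable_obj A) : concept P :=
  @Concept P A (up A) (esym sA) erefl.

Definition concept_of_feat (B : set (feat P)) (sB : stable_feat B) : concept P :=
  @Concept P (down B) B erefl (esym sB).

Lemma stable_extent c : stable_obj (extent c).
Proof. by rewrite /stable_obj -intentE -extentE. Qed.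

Lemma stable_intent c : stable_feat (intent c).
Proof. by rewrite /stable_feat -extentE -intentE. Qed.

Lemma stable_down (B : set (feat P)) : stable_obj (down B).
Proof. exact: down_up_down. Qed.

Lemma stable_up (A : set (obj P)) : stable_feat (up A).
Proof. exact: up_down_up. Qed.

Lemma stable_objI (A A' : set (obj P)) :
  stable_obj A -> stable_obj A' -> stable_obj (A `&` A').
Proof.
move=> sA sA'; apply/seteqP; split; last exact: sub_down_up.
by move=> g H; split; [rewrite -sA|rewrite -sA'];
  apply: downS H; apply: upS => ? [].
Qed.

Lemma stable_featI (B B' : set (feat P)) :
  stable_feat B -> stable_feat B' -> stable_feat (B `&` B').
Proof.
move=> sB sB'; apply/seteqP; split; last exact: sub_up_down.
by move=> g H; split; [rewrite -sB|rewrite -sB'];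
  apply: upS H; apply: downS => ? [].
Qed.

Lemma sub_intent c d : extent c `<=` extent d <-> intent d `<=` intent c.
Proof.
split=> [s|s]; first by rewrite !intentE; apply: upS.
by rewrite !extentE; apply: downS.
Qed.

Definition cle : rel (concept P) := fun c d => `[< extent c `<=` extent d >].

Definition cmeet c d :=
  concept_of_obj (stable_objI (stable_extent c) (stable_extent d)).
Definition cjoin c d :=
  concept_of_feat (stable_featI (stable_intent c) (stable_intent d)).
Definition ctop : concept P := concept_of_feat (stable_up setT).
Definition cbot : concept P := concept_of_obj (stable_down setT).

Lemma cle_refl : reflexive cle.
Proof. by move=> c; apply/asboolP. Qed.

Lemma cle_anti : antisymmetric cle.
Proof.
move=> c d /andP[/asboolP cd /asboolP dc].
by apply: concept_inj; apply/seteqP.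
Qed.

Lemma cle_trans : transitive cle.
Proof.
move=> d c e /asboolP cd /asboolP de; apply/asboolP.
exact: subset_trans de.
Qed.

Lemma cmeetP c d e : cle c (cmeet d e) = cle c d && cle c e.
Proof.
apply/asboolP/andP => [H|[/asboolP cd /asboolP ce] g cg]; last first.
  by split; [apply: cd|apply: ce].
by split; apply/asboolP => g /H[].
Qed.

Lemma cjoinP c d e : cle (cjoin c d) e = cle c e && cle d e.
Proof.
apply/asboolP/andP => [/sub_intent H|[/asboolP ce /asboolP de]].
  by split; apply/asboolP/sub_intent => m /H[].
apply/sub_intent => m em.
by split; [apply: (sub_intent c e).1 em|apply: (sub_intent d e).1 em].
Qed.

Lemma cbotP c : cle cbot c.
Proof. by apply/asboolP/sub_intent => m _ g; apply. Qed.

Lemma ctopP c : cle c ctop.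
Proof. by apply/asboolP => g _ m; apply. Qed.

End ConceptLattice.

Fact concept_display : Order.disp_t. Proof. exact: Order.Disp tt tt. Qed.

HB.instance Definition _ (P : polarity) :=
  Order.Le_isPOrder.Build concept_display (concept P)
    cle_refl cle_anti cle_trans.
HB.instance Definition _ (P : polarity) :=
  Order.POrder_MeetJoin_isLattice.Build concept_display (concept P)
    cmeetP cjoinP.
HB.instance Definition _ (P : polarity) :=
  Order.hasBottom.Build concept_display (concept P) cbotP.
HB.instance Definition _ (P : polarity) :=
  Order.hasTop.Build concept_display (concept P) ctopP.

Record enriched_context := EnrichedContext {
  pol :> polarity;
  Rbox : obj pol -> feat pol -> Prop;
  Rdia : feat pol -> obj pol -> Prop;
  Rbox0_stable : forall m, stable_obj (polar0 Rbox [set m]);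
  Rbox1_stable : forall g, stable_feat (polar1 Rbox [set g]);
  Rdia0_stable : forall g, stable_feat (polar0 Rdia [set g]);
  Rdia1_stable : forall m, stable_obj (polar1 Rdia [set m]) }.

Section ModalOperators.
Context {F : enriched_context}.

Lemma stable_Rbox0 (B : set (feat F)) : stable_obj (polar0 (@Rbox F) B).
Proof.
apply/seteqP; split; last exact: sub_down_up.
move=> g H m Bm.
suff: polar0 (@Rbox F) [set m] g by apply.
rewrite -Rbox0_stable; apply: downS H; apply: upS.
by move=> g' H' _ ->; apply: H'.
Qed.

Lemma stable_Rdia0 (A : set (obj F)) : stable_feat (polar0 (@Rdia F) A).
Proof.
apply/seteqP; split; last exact: sub_up_down.
move=> m H g Ag.
suff: polar0 (@Rdia F) [set g] m by apply.
rewrite -Rdia0_stable; apply: upS H; apply: downS.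
by move=> m' H' _ ->; apply: H'.
Qed.

Definition cbox (c : concept F) : concept F :=
  concept_of_obj (stable_Rbox0 (intent c)).
Definition cdia (c : concept F) : concept F :=
  concept_of_feat (stable_Rdia0 (extent c)).

End ModalOperators.

(* Greatest and least fixed points; the default values are irrelevant for a
   monotone map, for which the fixed points exist since P^+ is complete. *)
Definition is_lfp {P : polarity} (f : concept P -> concept P) (c : concept P) :=
  f c = c /\ forall d, f d = d -> (c <= d)%O.
Definition is_gfp {P : polarity} (f : concept P -> concept P) (c : concept P) :=
  f c = c /\ forall d, f d = d -> (d <= c)%O.
Definition lfp {P : polarity} (f : concept P -> concept P) : concept P :=
  xget (Order.bottom : concept P) [set c | is_lfp f c].
Definition gfp {P : polarity} (f : concept P -> concept P) : concept P :=
  xget (Order.top : concept P) [set c | is_gfp f c].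

Section Formulas.
Context {At : countType} {X Y : eqType}.

(* inl : the variables in X (bound by nu), inr : those in Y (bound by mu) *)
Definition var : Type := (X + Y)%type.

Inductive formula : Type :=
| Atom of At
| Var of var
| Bot
| Top
| Or of formula & formula
| And of formula & formula
| Box of formula
| Dia of formula
| Mu of Y & formula
| Nu of X & formula.

Implicit Types (phi psi : formula) (z : var).

Fixpoint fv phi : seq var :=
  match phi with
  | Var z => [:: z]
  | Atom _ | Bot | Top => [::]
  | Or a b | And a b => fv a ++ fv b
  | Box a | Dia a => fv a
  | Mu y a => [seq z <- fv a | z != inr y]
  | Nu x a => [seq z <- fv a | z != inl x]
  end.

(* one entry for each occurrence of a fixed-point operator *)
Fixpoint bv phi : seq var :=
  match phi with
  | Atom _ | Var _ | Bot | Top => [::]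
  | Or a b | And a b => bv a ++ bv b
  | Box a | Dia a => bv a
  | Mu y a => inr y :: bv a
  | Nu x a => inl x :: bv a
  end.

Definition well_named phi : Prop :=
  uniq (bv phi) /\ forall z, z \in fv phi -> z \notin bv phi.

Fixpoint subformula psi phi : Prop :=
  psi = phi \/
  match phi with
  | Atom _ | Var _ | Bot | Top => False
  | Or a b | And a b => subformula psi a \/ subformula psi b
  | Box a | Dia a | Mu _ a | Nu _ a => subformula psi a
  end.

Definition bind z psi : formula :=
  match z with inl x => Nu x psi | inr y => Mu y psi end.

(* The dependency order is the bare relation, without transitive closure. This
   does not affect which variable is maximal among those occurring infinitely
   often in a play: a play can leave [psi] only through a free variable. *)
Definition dep_le phi z1 z2 : Prop :=
  exists2 psi, subformula (bind z1 psi) phi & z2 \in fv psi.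

End Formulas.

Arguments var : clear implicits.
Arguments formula : clear implicits.

Section Semantics.
Context {At : countType} {X Y : eqType} {F : enriched_context}.

(* Total on variables; only the values at free variables matter. *)
Record valuation := Valuation {
  val_atom : At -> concept F;
  val_var : var X Y -> concept F }.

Definition upd (V : valuation) (z : var X Y) (c : concept F) : valuation :=
  Valuation (val_atom V) (fun z' => if z' == z then c else val_var V z').

Fixpoint interp (V : valuation) (phi : formula At X Y) : concept F :=
  match phi with
  | Atom p => val_atom V p
  | Var z => val_var V z
  | Bot => Order.bottom
  | Top => Order.top
  | Or a b => Order.join (interp V a) (interp V b)
  | And a b => Order.meet (interp V a) (interp V b)
  | Box a => cbox (interp V a)
  | Dia a => cdia (interp V a)
  | Mu y a => lfp (fun c => interp (upd V (inr y) c) a)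
  | Nu x a => gfp (fun c => interp (upd V (inl x) c) a)
  end.

Definition sat (V : valuation) (g : obj F) (phi : formula At X Y) : Prop :=
  extent (interp V phi) g.

Definition cosat (V : valuation) (m : feat F) (phi : formula At X Y) : Prop :=
  intent (interp V phi) m.

End Semantics.

Arguments valuation : clear implicits.

Inductive player := Eloise | Abelard.

Section Game.
Context {At : countType} {X Y : eqType} {F : enriched_context}.
Variables (V : valuation At X Y F) (Phi : formula At X Y).

Inductive position :=
| ObjPos of obj F & formula At X Y
| FeatPos of feat F & formula At X Y.

Definition form_of (p : position) : formula At X Y :=
  match p with ObjPos _ psi => psi | FeatPos _ psi => psi end.

(* None: the unique move is forced and belongs to no player. *)
Definition owner (p : position) : option player :=
  match p with
  | ObjPos _ (Nu _ _) => None
  | ObjPos _ (Var (inl x)) => if inl x \in bv Phi then None else Some Abelard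
  | ObjPos _ _ => Some Abelard
  | FeatPos _ (Mu _ _) => None
  | FeatPos _ (Var (inr y)) => if inr y \in bv Phi then None else Some Eloise
  | FeatPos _ _ => Some Eloise
  end.

(* g I^c m, seen from either side: the position changes, the formula stays. *)
Definition to_feat (g : obj F) (psi : formula At X Y) : set position :=
  [set FeatPos m psi | m in [set m | ~ inc g m]].
Definition to_obj (m : feat F) (psi : formula At X Y) : set position :=
  [set ObjPos g psi | g in [set g | ~ inc g m]].

Definition moves (p : position) : set position :=
  match p with
  | ObjPos g psi =>
    match psi with
    | Atom _ => [set q | ~ sat V g psi /\ to_feat g psi q]
    | Var z =>
      if z \in bv Phi then
        match z with
        | inl x => [set ObjPos g (Nu x a) | a in [set a | subformula (Nu x a) Phi]]
        | inr _ => to_feat g psi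
        end
      else [set q | ~ sat V g psi /\ to_feat g psi q]
    | Top => set0
    | Bot => to_feat g psi
    | Or _ _ => to_feat g psi
    | And a b => [set ObjPos g a; ObjPos g b]
    | Dia _ => to_feat g psi
    | Box a => [set FeatPos m a | m in [set m | ~ Rbox g m]]
    | Nu _ a => [set ObjPos g a]
    | Mu _ _ => to_feat g psi
    end
  | FeatPos m psi =>
    match psi with
    | Atom _ => [set q | ~ cosat V m psi /\ to_obj m psi q]
    | Var z =>
      if z \in bv Phi then
        match z with
        | inl _ => to_obj m psi
        | inr y => [set FeatPos m (Mu y a) | a in [set a | subformula (Mu y a) Phi]]
        end
      else [set q | ~ cosat V m psi /\ to_obj m psi q]
    | Top => to_obj m psi
    | Bot => set0
    | Or a b => [set FeatPos m a; FeatPos m b]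
    | And _ _ => to_obj m psi
    | Dia a => [set ObjPos g a | g in [set g | ~ Rdia m g]]
    | Box _ => to_obj m psi
    | Nu _ _ => to_obj m psi
    | Mu _ a => [set FeatPos m a]
    end
  end.

Definition other (pl : player) : player :=
  match pl with Eloise => Abelard | Abelard => Eloise end.

Definition var_player (z : var X Y) : player :=
  match z with inl _ => Eloise | inr _ => Abelard end.

Definition inf_often (u : nat -> position) (z : var X Y) : Prop :=
  forall n, exists2 k, n <= k & form_of (u k) = Var z.

Definition max_inf_var (u : nat -> position) (z : var X Y) : Prop :=
  [/\ z \in bv Phi, inf_often u z
    & forall z', z' \in bv Phi -> inf_often u z' -> dep_le Phi z z' -> z' = z].

(* An infinite play without a bound variable occurring infinitely often (it then
   alternates for ever between [ObjPos _ p] and [FeatPos _ p] for an atom or a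
   free variable [p]) is won by neither player. *)
Definition wins_infinite (pl : player) (u : nat -> position) : Prop :=
  exists2 z, max_inf_var u z & var_player z = pl.

(* a finite play ending in [p] that cannot be continued *)
Definition wins_stuck (pl : player) (p : position) : Prop :=
  owner p = Some (other pl).

(* A partial play from [p0] is the nonempty sequence [p0 :: s]. *)
Definition partial_play (p0 : position) (s : seq position) : Prop :=
  forall i, i < size s -> moves (nth p0 (p0 :: s) i) (nth p0 (p0 :: s) i.+1).

(* A strategy maps each partial play to the next position; its values matter
   only at partial plays whose last position is owned by the player. *)
Definition strategy := seq position -> position.

Definition legal (pl : player) (p0 : position) (sigma : strategy) : Prop :=
  forall s, partial_play p0 s -> owner (last p0 s) = Some pl ->
    moves (last p0 s) !=set0 -> moves (last p0 s) (sigma (p0 :: s)).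

Definition follows (pl : player) (sigma : strategy)
    (p0 : position) (s : seq position) : Prop :=
  forall i, i < size s -> owner (nth p0 (p0 :: s) i) = Some pl ->
    nth p0 (p0 :: s) i.+1 = sigma (take i.+1 (p0 :: s)).

(* An infinite play from [p0] is [u] with [u 0 = p0]; its finite prefixes are
   the sequences [p0; u 1; ...; u n]. *)
Definition winning (pl : player) (p0 : position) (sigma : strategy) : Prop :=
  [/\ legal pl p0 sigma,
      forall s, partial_play p0 s -> follows pl sigma p0 s ->
        moves (last p0 s) = set0 -> wins_stuck pl (last p0 s)
    & forall u : nat -> position, u 0 = p0 ->
        (forall n, let s := [seq u i | i <- iota 1 n] in
          partial_play p0 s /\ follows pl sigma p0 s) ->
        wins_infinite pl u].

Definition has_winning_strategy (pl : player) (p0 : position) : Prop :=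
  exists sigma : strategy, winning pl p0 sigma.

End Game.

(* Main.v *)
(* Call a position good for a player if its truth value favours that player. From
   a good position the player can always move so as to stay in good positions, and
   the opponent cannot leave them; only infinite plays need care. The fixed points
   that the player must unfold finitely often (least ones for Eloise, greatest ones
   for Abelard) are therefore evaluated as approximants, indexed by well-founded
   trees carried along the play: unfolding such a variable replaces its tree by a
   subtree, while changes to variables it encloses do not affect it. In an infinite
   play the maximal variable occurring infinitely often is eventually never left, so
   its tree would descend for ever if it were losing. Hence each player wins from
   every position good for them, and since an infinite play has only one maximal
   variable, both players cannot win from the same position. *)
Require Import Defs.
From mathcomp Require Import all_boot all_order.
From mathcomp Require Import boolp classical_sets.
Import Order.Theory.

Set Implicit Arguments.
Unset Strict Implicit.
Unset Printing Implicit Defensive.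

Local Open Scope classical_set_scope.

(** * Completeness of the concept lattice and its fixed points *)

Section CompleteConceptLattice.
Context {P : polarity}.
Implicit Types (c d : concept P) (A : set (concept P)).
Implicit Type f : concept P -> concept P.

Lemma concept_leP c d : (c <= d)%O <-> extent c `<=` extent d.
Proof. by split=> [/asboolP|?]; last exact/asboolP. Qed.

Definition csup A : concept P :=
  concept_of_feat (stable_up (\bigcup_(c in A) extent c)).
Definition cinf A : concept P :=
  concept_of_obj (stable_down (\bigcup_(c in A) intent c)).

(** Only the intent of a supremum is pointwise, its extent being a closure; dually for infima. This
    asymmetry decides at which kind of position an approximant can be split. *)
Lemma intent_csup A m : intent (csup A) m <-> forall c, A c -> intent c m.
Proof.
split=> [H c Ac|H g [c Ac cg]].
  by rewrite intentE => g cg; apply: H; exists c.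
by move: (H c Ac); rewrite intentE; apply.
Qed.

Lemma extent_cinf A g : extent (cinf A) g <-> forall c, A c -> extent c g.
Proof.
split=> [H c Ac|H m [c Ac cm]].
  by rewrite extentE => m cm; apply: H; exists c.
by move: (H c Ac); rewrite extentE; apply.
Qed.

Lemma csup_ub A c : A c -> (c <= csup A)%O.
Proof.
by move=> Ac; apply/concept_leP/sub_intent => m /intent_csup; apply.
Qed.

Lemma csup_le A d : (forall c, A c -> (c <= d)%O) -> (csup A <= d)%O.
Proof.
move=> H; apply/concept_leP/sub_intent => m dm; apply/intent_csup => c /H.
by move=> /concept_leP/sub_intent; apply.
Qed.

Lemma cinf_lb A c : A c -> (cinf A <= c)%O.
Proof. by move=> Ac; apply/concept_leP => g /extent_cinf; apply. Qed.

Lemma cinf_ge A d : (forall c, A c -> (d <= c)%O) -> (d <= cinf A)%O.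
Proof.
move=> H; apply/concept_leP => g dg; apply/extent_cinf => c /H.
by move=> /concept_leP; apply.
Qed.

Definition cmono f := forall c d, (c <= d)%O -> (f c <= f d)%O.

(** Knaster-Tarski, as the meet of all prefixed points; it ensures that [lfp] never takes its
    default value. *)
Lemma is_lfp_cinf f : cmono f -> is_lfp f (cinf [set d | (f d <= d)%O]).
Proof.
move=> fm; set l := cinf _.
have fl : (f l <= l)%O.
  apply: cinf_ge => d /= fd; apply: le_trans (fd).
  by apply: fm; apply: cinf_lb.
split; last by move=> d fd; apply: cinf_lb; rewrite /= fd.
by apply/le_anti/andP; split => //; apply: cinf_lb; exact: (fm _ _ fl).
Qed.

Lemma is_gfp_csup f : cmono f -> is_gfp f (csup [set d | (d <= f d)%O]).
Proof.
move=> fm; set l := csup _.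
have fl : (l <= f l)%O.
  apply: csup_le => d /= fd; apply: le_trans (fd) _.
  by apply: fm; apply: csup_ub.
split; last by move=> d fd; apply: csup_ub; rewrite /= fd.
by apply/le_anti/andP; split => //; apply: csup_ub; exact: (fm _ _ fl).
Qed.

Lemma lfp_fix f : cmono f -> f (lfp f) = lfp f.
Proof.
move=> fm; have : is_lfp f (lfp f); last by case.
by apply: (@xgetPex _ _ [set c | is_lfp f c]); exists (cinf [set d | (f d <= d)%O]);
  exact: is_lfp_cinf.
Qed.

Lemma gfp_fix f : cmono f -> f (gfp f) = gfp f.
Proof.
move=> fm; have : is_gfp f (gfp f); last by case.
by apply: (@xgetPex _ _ [set c | is_gfp f c]); exists (csup [set d | (d <= f d)%O]);
  exact: is_gfp_csup.
Qed.

Lemma lfp_ind f d : cmono f -> (f d <= d)%O -> (lfp f <= d)%O.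
Proof.
move=> fm fd; have [lf _] := is_lfp_cinf fm.
apply: (@le_trans _ _ (cinf [set d | (f d <= d)%O])); last exact: cinf_lb.
have : is_lfp f (lfp f); last by case=> _; apply.
by apply: (@xgetPex _ _ [set c | is_lfp f c]); exists (cinf [set d | (f d <= d)%O]);
  exact: is_lfp_cinf.
Qed.

Lemma gfp_coind f d : cmono f -> (d <= f d)%O -> (d <= gfp f)%O.
Proof.
move=> fm fd; have [lf _] := is_gfp_csup fm.
apply: (@le_trans _ _ (csup [set d | (d <= f d)%O])); first exact: csup_ub.
have : is_gfp f (gfp f); last by case=> _; apply.
by apply: (@xgetPex _ _ [set c | is_gfp f c]); exists (csup [set d | (d <= f d)%O]);
  exact: is_gfp_csup.
Qed.

End CompleteConceptLattice.

(* Well-founded trees play the role of ordinals: [approx sup f] is the approximant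
   of the fixed point of [f] that a tree denotes. *)
Inductive tree (T : Type) : Type :=
| Leaf
| Node of T -> tree T.

Arguments Leaf {T}.

(** * Tree-indexed approximants and well-founded descent *)

Section Trees.
Context {T : Type} (sup : set T -> T) (f : T -> T).

Fixpoint approx (t : tree T) : T :=
  match t with
  | Leaf => sup set0
  | Node ch => sup [set f (approx (ch a)) | a in setT]
  end.

Definition child (t' t : tree T) : Prop :=
  match t with Leaf => False | Node ch => exists a, t' = ch a end.

(** Nodes branch over all of [T], so one node can have children realising every value that an
    approximant takes. Its own value [s] is among these, so the child at [s] contributes [f s] to
    the limit that defines [s]. *)
Lemma tree_prefixed (le : T -> T -> Prop) :
  (forall (A : set T) c, A c -> le c (sup A)) ->
  exists t, le (f (approx t)) (approx t).
Proof.
move=> ub.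
have /choice[ch chP] : forall c, exists t, (exists t', approx t' = c) -> approx t = c.
  move=> c; have [[t tc]|nt] := pselect (exists t, approx t = c).
    by exists t.
  by exists Leaf => /nt.
exists (Node ch); set s := approx (Node ch).
rewrite -[in f s](chP s); last by exists (Node ch).
by apply: (ub [set f (approx (ch a)) | a in setT]); exists s.
Qed.

(** Stationary steps are skipped until a proper child appears ([next]); structural induction on the
    tree reached then excludes going on for ever. *)
Lemma no_infinite_descent (r : nat -> tree T) (N : nat) :
  (forall i, N <= i -> r i.+1 = r i \/ child (r i.+1) (r i)) ->
  (forall i, N <= i -> exists2 j, i <= j & child (r j.+1) (r j)) ->
  False.
Proof.
move=> mono dec.
have next i : N <= i -> exists2 j, N <= j & child (r j) (r i).
  move=> Ni; have [j ij] := dec i Ni; rewrite -(subnKC ij).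
  move: (j - i) => d {ij}; elim: d i Ni => [|d IH] i Ni.
    by rewrite addn0; exists i.+1 => //; apply: leqW.
  case: (mono i Ni) => [e|c _]; last by exists i.+1 => //; apply: leqW.
  by rewrite addnS -addSn -e; apply: IH; apply: leqW.
suff H : forall t i, N <= i -> r i = t -> False by apply: (H (r N) N).
elim=> [|ch IH] i Ni ri; have [j Nj] := next i Ni; rewrite ri //.
by case=> a; apply: IH.
Qed.

End Trees.

(** * Subformulas, binders and the order of dependencies *)

Section Formulas.
Context {At : countType} {X Y : eqType}.
Implicit Types (phi psi a b : formula At X Y) (z : var X Y).

Fixpoint fsize phi : nat :=
  match phi with
  | Atom _ | Var _ | Bot | Top => 1
  | Or a b | And a b => (fsize a + fsize b).+1
  | Box a | Dia a | Mu _ a | Nu _ a => (fsize a).+1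
  end.

Lemma subformula_refl phi : subformula phi phi.
Proof. by case: phi => *; left. Qed.

Lemma subformula_trans psi phi chi :
  subformula psi phi -> subformula phi chi -> subformula psi chi.
Proof.
move=> sp; elim: chi => [p|z|||a IHa b IHb|a IHa b IHb|a IH|a IH|y a IH|x a IH]
  /= [e|h]; rewrite ?e in sp *; try exact: sp; try (by []); right; auto.
- by case: h => [/IHa|/IHb]; [left|right].
- by case: h => [/IHa|/IHb]; [left|right].
Qed.

Lemma subformula_size psi phi : subformula psi phi -> psi = phi \/ fsize psi < fsize phi.
Proof.
elim: phi => [p|z|||a IHa b IHb|a IHa b IHb|a IH|a IH|y a IH|x a IH]
  /= [e|//]; try (by left).
- by case=> [/IHa|/IHb] [->|h]; right; rewrite ltnS ?leq_addr ?leq_addl //;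
    [apply/ltnW/(leq_trans h)/leq_addr|apply/ltnW/(leq_trans h)/leq_addl].
- by case=> [/IHa|/IHb] [->|h]; right; rewrite ltnS ?leq_addr ?leq_addl //;
    [apply/ltnW/(leq_trans h)/leq_addr|apply/ltnW/(leq_trans h)/leq_addl].
all: by move=> /IH[->|h]; right; rewrite ltnS // ltnW.
Qed.

Lemma subformula_size_le psi phi : subformula psi phi -> fsize psi <= fsize phi.
Proof. by move=> /subformula_size[->|/ltnW]. Qed.

Lemma subformula_bind z a : subformula a (bind z a).
Proof. by case: z => z; right; apply: subformula_refl. Qed.

Lemma fsize_bind z a : fsize (bind z a) = (fsize a).+1.
Proof. by case: z. Qed.

Lemma fv_bind z a : fv (bind z a) = [seq w <- fv a | w != z].
Proof. by case: z. Qed.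

Lemma bv_bind z a : bv (bind z a) = z :: bv a.
Proof. by case: z. Qed.

Lemma bind_inj z a z' a' : bind z a = bind z' a' -> z = z' /\ a = a'.
Proof. by case: z; case: z' => u v //= [-> ->]. Qed.

Lemma sub_bv psi phi : subformula psi phi -> {subset bv psi <= bv phi}.
Proof.
elim: phi => [p|z|||a IHa b IHb|a IHa b IHb|a IH|a IH|y a IH|x a IH] /= [e|h] w wp;
  try (by rewrite e in wp); rewrite ?mem_cat ?in_cons //.
- by case: h => [/IHa|/IHb] h; rewrite h ?orbT.
- by case: h => [/IHa|/IHb] h; rewrite h ?orbT.
- exact: (IH h).
- exact: (IH h).
- by rewrite (IH h) ?orbT.
- by rewrite (IH h) ?orbT.
Qed.

Lemma sub_fv psi phi z :
  subformula psi phi -> z \in fv psi -> z \in fv phi \/ z \in bv phi.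
Proof.
elim: phi => [p|w|||a IHa b IHb|a IHa b IHb|a IH|a IH|y a IH|x a IH] /= [e|h] wp;
  try (by left; rewrite e in wp); rewrite ?mem_cat ?mem_filter ?in_cons //.
- by case: h => [/IHa|/IHb] /(_ wp)[] ->; rewrite ?orbT; auto.
- by case: h => [/IHa|/IHb] /(_ wp)[] ->; rewrite ?orbT; auto.
- exact: (IH h).
- exact: (IH h).
- by case: eqP => _; [right|case: (IH h wp) => ->; auto].
- by case: eqP => _; [right|case: (IH h wp) => ->; auto].
Qed.

Lemma bind_in_bv z a phi : subformula (bind z a) phi -> z \in bv phi.
Proof. by move/sub_bv; apply; rewrite bv_bind mem_head. Qed.

Lemma bv_bindP z phi : z \in bv phi -> exists a, subformula (bind z a) phi.
Proof.
elim: phi => [p|w|||a IHa b IHb|a IHa b IHb|a IH|a IH|y a IH|x a IH] //=.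
- by rewrite mem_cat => /orP[/IHa|/IHb] [c ?]; exists c; right; [left|right].
- by rewrite mem_cat => /orP[/IHa|/IHb] [c ?]; exists c; right; [left|right].
- by move=> /IH[c ?]; exists c; right.
- by move=> /IH[c ?]; exists c; right.
- by rewrite inE => /orP[/eqP->|/IH[c ?]]; [exists a; left|exists c; right].
- by rewrite inE => /orP[/eqP->|/IH[c ?]]; [exists a; left|exists c; right].
Qed.

(** [bv] has one entry per binder occurrence, so two different binders of [z] would produce a
    duplicate. *)
Lemma bind_unique phi z a b : uniq (bv phi) ->
  subformula (bind z a) phi -> subformula (bind z b) phi -> a = b.
Proof.
elim: phi => [p|w|||c IHc d IHd|c IHc d IHd|c IH|c IH|y c IH|x c IH] /=.
1-4: by move=> _ [|//]; case: (z).
1,2: rewrite cat_uniq => /and3P[uc /hasPn dj ud].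
1,2: move=> [|sa]; first by case: (z).
1,2: move=> [|sb]; first by case: (z).
1,2: case: sa sb => sa [] sb; try exact: IHc; try exact: IHd.
1-4: move: (bind_in_bv sa) (bind_in_bv sb) => h1 h2.
1,3: by have := dj _ h2; rewrite /= h1.
1,2: by have := dj _ h1; rewrite /= h2.
1,2: move=> uc [|sa]; first by case: (z).
1,2: move=> [|sb]; first by case: (z).
1,2: exact: IH.
all: move=> /andP[nc uc] [ea|sa] [eb|sb].
- by move: ea eb; case: (z) => // v [_ ->] [_ ->].
- by have := bind_in_bv sb; move: ea; case: (z) => // v [-> _] h; rewrite h in nc.
- by have := bind_in_bv sa; move: eb; case: (z) => // v [-> _] h; rewrite h in nc.
- exact: IH.
- by move: ea eb; case: (z) => // v [_ ->] [_ ->].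
- by have := bind_in_bv sb; move: ea; case: (z) => // v [-> _] h; rewrite h in nc.
- by have := bind_in_bv sa; move: eb; case: (z) => // v [-> _] h; rewrite h in nc.
- exact: IH.
Qed.

(* [bv] lists the binders in preorder, so enclosing binders come first. *)
Lemma fv_bind_index phi z a w : uniq (bv phi) ->
  subformula (bind z a) phi -> w \in fv (bind z a) ->
  w \in fv phi \/ w \in bv phi /\ index w (bv phi) < index z (bv phi).
Proof.
move=> + + wf.
elim: phi => [p|u|||c IHc d IHd|c IHc d IHd|c IH|c IH|y c IH|x c IH] /=.
1-4: by move=> _ [|//]; move: wf; case: (z).
1,2: rewrite cat_uniq => /and3P[uc /hasPn dj ud].
1,2: move=> [|sa]; first by move: wf; case: (z).
1,2: rewrite !mem_cat !index_cat; case: sa => sa; have zb := bind_in_bv sa.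
1,3: by rewrite zb; case: (IHc uc sa) => [->|[wc lt]]; [left|right; rewrite wc].
1,2: have /negbTE zc := dj _ zb; rewrite /= in zc; rewrite zc.
1,2: case: (IHd ud sa) => [->|[wd lt]]; [by left; rewrite orbT|right].
1,2: by have /negbTE wc := dj _ wd; rewrite /= in wc; rewrite wc wd ltn_add2l.
1,2: move=> uc [|sa]; first by move: wf; case: (z).
1,2: exact: IH.
all: move=> /andP[nc uc] [e|sa]; first by left; move: wf; rewrite e.
all: have zb := bind_in_bv sa; have zn : z \in bv c by [].
all: rewrite mem_filter inE.
- have -> : (inr y == z) = false by apply/eqP => e; rewrite e zb in nc.
  rewrite [inr y == w]eq_sym; case: eqP => /= [_|_]; first by right.
  by case: (IH uc sa) => [|[]] ; [left|right].
- have -> : (inl x == z) = false by apply/eqP => e; rewrite e zb in nc.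
  rewrite [inl x == w]eq_sym; case: eqP => /= [_|_]; first by right.
  by case: (IH uc sa) => [|[]] ; [left|right].
Qed.

End Formulas.

(** * Monotonicity and locality of the interpretation *)

Section Semantics.
Context {At : countType} {X Y : eqType} {F : enriched_context}.
Implicit Types (phi psi a : formula At X Y) (z : var X Y) (c d : concept F).
Implicit Type U : valuation At X Y F.

Lemma cbox_le c d : (c <= d)%O -> (cbox c <= cbox d)%O.
Proof.
move=> /concept_leP/sub_intent cd; apply/concept_leP => g H m /cd.
exact: H.
Qed.

Lemma cdia_le c d : (c <= d)%O -> (cdia c <= cdia d)%O.
Proof.
move=> /concept_leP cd; apply/concept_leP/sub_intent => m H g /cd.
exact: H.
Qed.

Lemma interp_le phi U U' : val_atom U = val_atom U' ->
  (forall z, z \in fv phi -> (val_var U z <= val_var U' z)%O) ->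
  (interp U phi <= interp U' phi)%O.
Proof.
elim: phi U U' => [p|z|||a IHa b IHb|a IHa b IHb|a IH|a IH|y a IH|x a IH]
    /= U U' eU leU //.
- by rewrite eU.
- by apply: leU; rewrite inE.
- by apply: leU2; [apply: IHa|apply: IHb] => // z zf; apply: leU;
    rewrite mem_cat zf ?orbT.
- by apply: leI2; [apply: IHa|apply: IHb] => // z zf; apply: leU;
    rewrite mem_cat zf ?orbT.
- exact/cbox_le/IH.
- exact/cdia_le/IH.
(* The induction hypothesis, applied to valuations that differ only at the bound variable, makes the
   body monotone and so gives access to the fixed-point laws. *)
- have mono U1 : cmono (fun c => interp (upd U1 (inr y) c) a).
    by move=> c d cd; apply: IH => //= z _; case: ifP.
  apply: lfp_ind => //; rewrite -[leRHS]lfp_fix //.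
  apply: IH => //= z zf; case: ifP => // zy.
  by apply: leU; rewrite mem_filter zf zy.
- have mono U1 : cmono (fun c => interp (upd U1 (inl x) c) a).
    by move=> c d cd; apply: IH => //= z _; case: ifP.
  apply: gfp_coind => //; rewrite -[leLHS]gfp_fix //.
  apply: IH => //= z zf; case: ifP => // zy.
  by apply: leU; rewrite mem_filter zf zy.
Qed.

Lemma interp_ext phi U U' : val_atom U = val_atom U' ->
  (forall z, z \in fv phi -> val_var U z = val_var U' z) ->
  interp U phi = interp U' phi.
Proof.
move=> eU eV; apply/le_anti/andP.
by split; apply: interp_le => // z /eV ->.
Qed.

Definition fixp z (f : concept F -> concept F) : concept F :=
  match z with inl _ => gfp f | inr _ => lfp f end.

Lemma interp_bind U z a :
  interp U (bind z a) = fixp z (fun c => interp (upd U z c) a).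
Proof. by case: z. Qed.

Lemma interp_mono U z a : cmono (fun c => interp (upd U z c) a).
Proof. by move=> c d cd; apply: interp_le => //= w _; case: ifP. Qed.

Lemma fixp_fix z f : cmono f -> f (fixp z f) = fixp z f.
Proof. by case: z => z; [apply: gfp_fix|apply: lfp_fix]. Qed.

End Semantics.

(** * Good positions, treated uniformly for both players *)

Section Goodness.
Context {At : countType} {X Y : eqType} {F : enriched_context}.
Local Notation pos := (@position At X Y F).
Implicit Types (p q : pos) (pl : player) (c d : concept F).

Definition is_obj p : bool := if p is ObjPos _ _ then true else false.

(** The concept is a parameter, detached from the formula in the position, so that approximants can
    judge a position as well as exact values. *)
Definition holds c p : Prop :=
  match p with ObjPos g _ => extent c g | FeatPos m _ => ~ intent c m end.

Definition good pl c p : Prop :=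
  match pl with Eloise => holds c p | Abelard => ~ holds c p end.

Definition lim pl : set (concept F) -> concept F :=
  match pl with Eloise => csup | Abelard => cinf end.

Definition losing pl (z : var X Y) : bool :=
  match pl, z with
  | Eloise, inr _ | Abelard, inl _ => true
  | _, _ => false
  end.

Lemma holds_le c d p : (c <= d)%O -> holds c p -> holds d p.
Proof.
move=> /concept_leP cd; case: p => [g|m] _ /=; first exact: cd.
by apply: contra_not => /(sub_intent c d).1; apply.
Qed.

Lemma good_lim pl (A : set (concept F)) c p : A c -> good pl c p -> good pl (lim pl A) p.
Proof.
by case: pl => /= Ac; [|apply: contra_not]; apply: holds_le;
  [apply: csup_ub|apply: cinf_lb].
Qed.

Definition home_var (z : var X Y) : bool := if z is inl _ then true else false.

(** At a home position of a losing variable the limit is read on its pointwise side: a feature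
    outside the intent of a join is outside some intent, and dually for objects and meets. *)
Lemma good_lim_home pl z (A : set (concept F)) p :
  losing pl z -> is_obj p = home_var z -> good pl (lim pl A) p ->
  exists2 c, A c & good pl c p.
Proof.
case: pl z p => [] [] // _ [] // n _ _ _ /=.
  move=> H; apply: contrapT => nA; apply: H; apply/intent_csup => c Ac.
  by apply: contrapT => nc; apply: nA; exists c.
move=> H; apply: contrapT => nA; apply: H; apply/extent_cinf => c Ac.
by apply: contrapT => nc; apply: nA; exists c.
Qed.

(** The hypothesis on [c] makes it a prefixed point for Eloise and a postfixed one for Abelard, so
    induction or coinduction applies. The order is tested on objects carrying [Top] as a dummy
    formula. *)
Lemma good_fixp pl z f c p : losing pl z -> cmono f ->
  (forall q, good pl (f c) q -> good pl c q) ->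
  good pl (fixp z f) p -> good pl c p.
Proof.
case: pl z => [] [] // z _ fm /= H.
  apply: holds_le; apply: lfp_ind => //; apply/concept_leP => g.
  exact: (H (ObjPos g (Top : formula At X Y))).
apply: contra_not; apply: holds_le; apply: gfp_coind => //.
apply/concept_leP => g.
have := H (ObjPos g (Top : formula At X Y)) => /= {}H cg.
by apply: contrapT => /H.
Qed.

End Goodness.

(** * Environments determined by ranks *)

Section Env.
Context {At : countType} {X Y : eqType} {F : enriched_context}.
Variables (V : valuation At X Y F) (Phi : formula At X Y).
Hypothesis Phi_wn : well_named Phi.
Variable pl : player.
Local Notation pos := (@position At X Y F).
Local Notation rank := (var X Y -> tree (concept F)).
Implicit Types (p q : pos) (z w : var X Y) (r : rank) (U : valuation At X Y F).

Lemma body_ex z :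
  exists a : formula At X Y, z \in bv Phi -> subformula (bind z a) Phi.
Proof.
have [/bv_bindP[a]|_] := boolP (z \in bv Phi); first by exists a.
by exists Bot.
Qed.

Definition body z : formula At X Y := projT1 (cid (body_ex z)).

Lemma bodyP z : z \in bv Phi -> subformula (bind z (body z)) Phi.
Proof. exact: projT2 (cid (body_ex z)). Qed.

Lemma body_eq z a : subformula (bind z a) Phi -> a = body z.
Proof.
move=> sa; apply: (bind_unique Phi_wn.1 sa).
exact/bodyP/(bind_in_bv sa).
Qed.

Definition value U z (t : tree (concept F)) : concept F :=
  let f c := interp (upd U z c) (body z) in
  if losing pl z then approx (lim pl) f t else fixp z f.

(** Folding along [bv], where enclosing binders come first, evaluates a variable after the bound
    variables on which its body depends. *)
Definition envl r (s : seq (var X Y)) : valuation At X Y F :=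
  foldl (fun U z => upd U z (value U z (r z))) V s.
Definition env r := envl r (bv Phi).

Definition idx z := index z (bv Phi).

Lemma envl_atom r s : val_atom (envl r s) = val_atom V.
Proof.
by elim/last_ind: s => //= s z IH; rewrite /envl foldl_rcons.
Qed.

Lemma envl_cat r s1 s2 w :
  w \notin s2 -> val_var (envl r (s1 ++ s2)) w = val_var (envl r s1) w.
Proof.
elim/last_ind: s2 => [|s2 z IH]; first by rewrite cats0.
rewrite mem_rcons inE negb_or => /andP[/negbTE wz /IH <-].
by rewrite -rcons_cat {1}/envl foldl_rcons /= wz.
Qed.

Lemma env_free r z : z \notin bv Phi -> val_var (env r) z = val_var V z.
Proof. exact: (@envl_cat r [::]). Qed.

(** Dependencies strictly decrease [idx], the measure behind the inductions on variables and the
    choice of an outermost variable. *)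
Lemma fv_body z w : z \in bv Phi -> w \in fv (body z) -> w != z ->
  w \in bv Phi -> idx w < idx z.
Proof.
move=> zb wf wz wb.
have wf' : w \in fv (bind z (body z)) by rewrite fv_bind mem_filter wz wf.
case: (fv_bind_index Phi_wn.1 (bodyP zb) wf') => [/Phi_wn.2|[]//].
by rewrite wb.
Qed.

Lemma value_ext U U' z t : val_atom U = val_atom U' ->
  (forall w, w \in fv (body z) -> w != z -> val_var U w = val_var U' w) ->
  value U z t = value U' z t.
Proof.
move=> eU eV; rewrite /value.
suff -> : (fun c => interp (upd U z c) (body z)) =
          (fun c => interp (upd U' z c) (body z)) by [].
apply/funext => c; apply: interp_ext => //= w wf.
by case: eqVneq => // wz; apply: eV.
Qed.

(** The fold evaluates [z] knowing only the earlier binders. By [fv_body] its body reads no later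
    one, so the complete environment yields the same value. *)
Lemma env_bv r z : z \in bv Phi -> val_var (env r) z = value (env r) z (r z).
Proof.
move=> zb.
have [s1 [s2 [es z1 z2]]] : exists s1 s2,
    [/\ bv Phi = s1 ++ z :: s2, z \notin s1 & z \notin s2].
  have := Phi_wn.1; case/splitPr: zb => s1 s2.
  rewrite cat_uniq /= negb_or => /and4P[_ /andP[zs1 _] zs2 _].
  by exists s1, s2.
have -> : val_var (env r) z = value (envl r s1) z (r z).
  rewrite /env es -cat_rcons envl_cat // /envl foldl_rcons /= eqxx.
  by [].
apply: value_ext; first by rewrite /env !envl_atom.
move=> w wf wz; rewrite /env es envl_cat //; apply/negP => w2.
have wb : w \in bv Phi by rewrite es mem_cat w2 orbT.
have := fv_body zb wf wz wb; rewrite /idx es !index_cat (negbTE z1) /= eqxx addn0.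
case: ifP => w1; last by rewrite ltnNge leq_addr.
have := Phi_wn.1; rewrite es cat_uniq => /and3P[_ /hasPn/(_ w w2)].
by rewrite /= w1.
Qed.

(** By induction on [idx], a value depends only on its own rank and on earlier ones; resetting the
    rank of an inner variable cannot disturb an outer one. *)
Lemma env_eq r r' z : (forall w, idx w <= idx z -> r w = r' w) ->
  val_var (env r) z = val_var (env r') z.
Proof.
have [n] := ubnP (idx z); elim: n z => // n IH z zn e.
have [zb|zb] := boolP (z \in bv Phi); last by rewrite !env_free.
rewrite !env_bv // e //; apply: value_ext; first by rewrite !envl_atom.
move=> w wf wz.
have [wb|wb] := boolP (w \in bv Phi); last by rewrite !env_free.
have lt := fv_body zb wf wz wb.
apply: IH; first exact: leq_trans lt zn.
by move=> v vw; apply: e; apply: leq_trans vw (ltnW lt).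
Qed.

Lemma value_env_eq r r' z t : z \in bv Phi ->
  (forall w, idx w < idx z -> r w = r' w) ->
  value (env r) z t = value (env r') z t.
Proof.
move=> zb e; apply: value_ext; first by rewrite !envl_atom.
move=> w wf wz.
have [wb|wb] := boolP (w \in bv Phi); last by rewrite !env_free.
have lt := fv_body zb wf wz wb.
by apply: env_eq => v vw; apply: e; apply: leq_ltn_trans vw lt.
Qed.

Lemma interp_env_eq r r' z c : z \in bv Phi ->
  (forall w, idx w < idx z -> r w = r' w) ->
  interp (upd (env r) z c) (body z) = interp (upd (env r') z c) (body z).
Proof.
move=> zb e; apply: interp_ext => /=; first by rewrite !envl_atom.
move=> w wf; case: eqVneq => // wz.
have [wb|wb] := boolP (w \in bv Phi); last by rewrite !env_free.
have lt := fv_body zb wf wz wb.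
by apply: env_eq => v vw; apply: e; apply: leq_ltn_trans vw lt.
Qed.

Definition setr r z (t : tree (concept F)) : rank :=
  fun w => if w == z then t else r w.

Lemma setr_lt r z t w : idx w < idx z -> r w = setr r z t w.
Proof. by rewrite /setr; case: eqVneq => // ->; rewrite ltnn. Qed.

(* A rank for [z] is chosen on arrival at [bind z a], before the unfolding, so
   that position is judged by the approximant of [z]. *)
Definition tv r (psi : formula At X Y) : concept F :=
  match psi with
  | Mu y _ => val_var (env r) (inr y)
  | Nu x _ => val_var (env r) (inl x)
  | _ => interp (env r) psi
  end.

Lemma tv_bind r z a : tv r (bind z a) = val_var (env r) z.
Proof. by case: z. Qed.

(** On arrival at a binder the exact fixed point gives way to a tree. [tree_prefixed] supplies one
    whose approximant is closed under unfolding with respect to goodness, and [good_fixp] carries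
    goodness over to it. *)
Lemma enter_good r psi q : subformula psi Phi ->
  good pl (interp (env r) psi) q ->
  exists r', good pl (tv r' psi) q /\
    forall w, (forall a, psi <> bind w a) -> r' w = r w.
Proof.
have [[z [a e]]|nb] := pselect (exists z a, psi = bind z a); last first.
  by move=> _ H; exists r; split=> //;
    case: psi nb H => [u|u|||a b|a b|a|a|v a|v a] nb H //;
    case: nb; [exists (inr v), a|exists (inl v), a].
rewrite e => sz; have zb := bind_in_bv sz.
rewrite interp_bind (body_eq sz) => H.
set f := (fun c => _) in H.
have fm : cmono f by apply: interp_mono.
have [t tP] : exists t, forall q,
    good pl (f (approx (lim pl) f t)) q -> good pl (approx (lim pl) f t) q.
  apply: (@tree_prefixed _ (lim pl) f (fun c d => forall q : pos,
    good pl c q -> good pl d q)) => A c Ac q'.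
  exact: good_lim.
exists (setr r z t); split; last first.
  by move=> w wz; rewrite /setr; case: eqVneq => // ez; case: (wz (body z)); rewrite ez.
rewrite tv_bind env_bv // /setr eqxx -/(setr r z t).
rewrite -(value_env_eq t zb (setr_lt r t)) /value -/f.
by case: ifP => // lz; apply: good_fixp H.
Qed.

(** A winning variable is unfolded by its fixed-point equation. For a losing one, [good_lim_home]
    selects a child of the node; a [Leaf] is a limit over the empty set, at which no home position
    is good. *)
Lemma unfold_good r z q : z \in bv Phi -> is_obj q = home_var z ->
  good pl (val_var (env r) z) q ->
  exists r', [/\ good pl (interp (env r') (body z)) q,
    forall w, w != z -> r' w = r w & losing pl z -> child (r' z) (r z)].
Proof.
move=> zb hq; rewrite env_bv // /value; set f := (fun c => _).
have fm : cmono f by apply: interp_mono.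
case: ifP => lz H; last first.
  exists r; split=> //; rewrite -(fixp_fix z fm) {1}/f in H.
  (* [env r] already assigns this fixed point to [z], so the update changes nothing. *)
  rewrite (_ : env r = upd (env r) z (fixp z f)) //.
  rewrite /upd; case E: (env r) => [Va Vv] /=; congr Valuation.
  apply/funext => w; case: eqVneq => // ->.
  have := env_bv r zb; rewrite /value lz -/f => <-.
  by rewrite E.
case E : (r z) H => [|ch] /= H.
  by have [c []] := good_lim_home lz hq H.
have [_ [c _ <-] {}H] := good_lim_home lz hq H.
exists (setr r z (ch c)); split; first last.
- by move=> _; exists c; rewrite /setr eqxx.
- by move=> w wz; rewrite /setr (negbTE wz).
set r' := setr r z (ch c).
have e' : val_var (env r') z = approx (lim pl) f (ch c).
  rewrite env_bv // /r' {2}/setr eqxx -(value_env_eq _ zb (setr_lt r (ch c))).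
  by rewrite /value lz.
rewrite /f (interp_env_eq _ zb (setr_lt r (ch c))) -/f -/r' -e' in H.
rewrite (_ : env r' = upd (env r') z (val_var (env r') z)) //.
rewrite /upd; case E': (env r') => [Va Vv] /=; congr Valuation.
by apply/funext => w; case: eqVneq => // ->.
Qed.

End Env.

(** * Preserving goodness in one move *)

Section Progress.
Context {At : countType} {X Y : eqType} {F : enriched_context}.
Variables (V : valuation At X Y F) (Phi : formula At X Y).
Hypothesis Phi_wn : well_named Phi.
Variable pl : player.
Local Notation pos := (@position At X Y F).
Local Notation rank := (var X Y -> tree (concept F)).
Local Notation env := (env V Phi pl).
Local Notation tv := (tv V Phi pl).
Implicit Types (p q : pos) (z w : var X Y) (r : rank).

(* [home_side psi] is the kind of positions [(n, psi)] that have moves to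
   subformulas; from the other kind every move keeps [psi]. At atoms and free
   variables a player's good positions at home are dead ends. *)
Definition home_side (psi : formula At X Y) : bool :=
  match psi with
  | Atom _ => if pl is Eloise then true else false
  | Var z => if z \in bv Phi then home_var z else if pl is Eloise then true else false
  | Top | And _ _ | Box _ | Nu _ _ => true
  | Bot | Or _ _ | Dia _ | Mu _ _ => false
  end.

Definition home p : bool := is_obj p == home_side (form_of p).

Definition good_state r p : Prop :=
  subformula (form_of p) Phi /\ good pl (tv r (form_of p)) p.

(** [Switch] ends at home, so two switches are never consecutive. Only [Descend] changes ranks: that
    of a losing binder it leaves goes down to a child, and that of a binder it enters is chosen
    afresh. *)
Variant step r p r' q : Prop :=
| Switch of form_of q = form_of p & r' = r & ~~ home p & home q
| Jump z of z \in bv Phi & form_of p = Var z &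
    form_of q = bind z (body Phi z) & r' = r & home p & home q
| Descend of fsize (form_of q) < fsize (form_of p) &
    subformula (form_of q) (form_of p) &
    (forall z a, form_of p = bind z a -> losing pl z -> child (r' z) (r z)) &
    (forall z, (forall a, form_of p <> bind z a) ->
       (forall a, form_of q <> bind z a) -> r' z = r z).

Definition advance r p q : Prop := exists r', good_state r' q /\ step r p r' q.

Definition flips p q : Prop :=
  match p with ObjPos g psi => to_feat g psi q | FeatPos m psi => to_obj m psi q end.

Definition flip_owner p : player := if is_obj p then Abelard else Eloise.

Lemma flip_form p q : flips p q -> form_of q = form_of p /\ is_obj q = ~~ is_obj p.
Proof. by case: p => n psi /= [? _ <-]. Qed.

(** Extent and intent determine each other: an object outside the extent has a non-incident feature
    in the intent, and dually. These are the witnesses that the owner of the flip needs; in the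
    other case every flip is harmless. *)
Lemma flip_good c p : good pl c p ->
  (pl = flip_owner p -> exists2 q, flips p q & good pl c q) /\
  (pl <> flip_owner p -> forall q, flips p q -> good pl c q).
Proof.
rewrite /flip_owner; case: p => [g|m] psi; case: pl => /= H;
  (split; [try by []|try by move=> /(_ erefl)]) => _.
- by move=> _ [m ngm <-] /=; rewrite intentE => /(_ g H).
- have : ~ Defs.down (intent c) g by rewrite -extentE.
  move=> /existsNP[m /not_implyP[cm ngm]].
  by exists (FeatPos m psi) => /=; [exists m|apply].
- have : ~ Defs.up (extent c) m by rewrite -intentE.
  move=> /existsNP[g /not_implyP[cg ngm]].
  by exists (ObjPos g psi) => //=; exists g.
- by move=> q [g ngm <-] /=; rewrite extentE => /(_ m (contrapT H)).
Qed.

(** At atoms and free variables the guard in [moves] follows from the goodness of the position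
    itself. *)
Lemma flip_moves r p q : good_state r p -> ~~ home p -> (flips p q <-> moves V Phi p q).
Proof.
have env_free' z : z \notin bv Phi -> val_var (env r) z = val_var V z by apply: env_free.
have env_atom : val_atom (env r) = val_atom V by apply: envl_atom.
rewrite /home; case: p => n [u|z|||a b|a b|a|a|v a|v a] [_ /=] //.
- rewrite env_atom; case: pl => //= H _; split=> [?|[]//]; split=> //.
- case: ifP => zb; first by case: z zb.
  rewrite env_free' ?zb //; case: pl => //= H _; split=> [?|[]//]; split=> //.
- rewrite env_atom; case: pl => //= H _; split=> [?|[]//]; split=> //.
- case: ifP => zb; first by case: z zb.
  rewrite env_free' ?zb //; case: pl => //= H _; split=> [?|[]//]; split=> //.
Qed.

Lemma flip_owner_moves p : ~~ home p -> owner Phi p = Some (flip_owner p).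
Proof.
rewrite /home; case: p => n [u|[z|z]|||a b|a b|a|a|v a|v a] //=.
- by case: ifP.
- by case: ifP.
Qed.

Lemma switch_advance r p q : good_state r p -> ~~ home p -> flips p q ->
  good pl (tv r (form_of p)) q -> advance r p q.
Proof.
move=> [sp _] np /flip_form[e ie] gq; exists r; split; first by split; rewrite e.
apply: Switch => //; move: np; rewrite /home e ie.
by case: is_obj; case: home_side.
Qed.

Lemma descend_advance r p q :
  subformula (form_of p) Phi -> (forall z a, form_of p <> bind z a) ->
  subformula (form_of q) (form_of p) -> fsize (form_of q) < fsize (form_of p) ->
  good pl (interp (env r) (form_of q)) q -> advance r p q.
Proof.
move=> sp nb sq lt gq; have sq' := subformula_trans sq sp.
have [r' [gq' er]] := enter_good Phi_wn sq' gq.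
exists r'; split; first by split.
apply: Descend => // z; first by move=> a /nb.
by move=> _; apply: er.
Qed.

Lemma unfold_advance r p q z : subformula (form_of p) Phi ->
  form_of p = bind z (form_of q) -> is_obj q = home_var z ->
  good pl (val_var (env r) z) q -> advance r p q.
Proof.
move=> sp e hq gq; rewrite e in sp; have zb := bind_in_bv sp.
have eb := body_eq Phi_wn sp.
have [r1 [g1 er1 c1]] := unfold_good Phi_wn zb hq gq.
rewrite -eb in g1.
have sq : subformula (form_of q) Phi.
  exact: subformula_trans (subformula_bind _ _) sp.
(* The body may itself be a binder, whose rank is then chosen in turn. *)
have [r2 [g2 er2]] := enter_good Phi_wn sq g1.
exists r2; split; first by split.
(* By size the body is not again a binder of [z], so this second choice leaves the descent of the
   rank of [z] intact. *)
have nz a : form_of q <> bind z a.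
  move=> eq; have := sq; rewrite eq => /(body_eq Phi_wn); rewrite -eb => ea.
  by have := fsize_bind z a; rewrite ea -{1}ea -eq => /n_Sn.
apply: Descend.
- by rewrite e fsize_bind.
- by rewrite e; apply: subformula_bind.
- by move=> w a; rewrite e => /bind_inj[<- _] lz; rewrite er2 //; apply: c1.
- move=> w nw nqw; rewrite er2 // er1 //; apply/eqP => ew.
  by case: (nw (form_of q)); rewrite ew.
Qed.

(** On the home side connectives are evaluated pointwise: conjunctions and boxes on objects,
    disjunctions and diamonds on features. Goodness thus yields a good successor for [pl] and passes
    to all successors otherwise. *)
Lemma advance_at_home r p : good_state r p -> home p ->
  (owner Phi p = Some pl -> exists2 q, moves V Phi p q & advance r p q) /\
  (owner Phi p <> Some pl -> forall q, moves V Phi p q -> advance r p q).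
Proof.
have env_free' z : z \notin bv Phi -> val_var (env r) z = val_var V z by apply: env_free.
have env_atom : val_atom (env r) = val_atom V by apply: envl_atom.
rewrite /home; case: p => [g|m] [u|[z|z]|||a b|a b|a|a|v a|v a] [sp gp] /= h;
  rewrite /= in sp gp *; try (by []).
- by rewrite env_atom in gp; move: h gp; case E: pl => //= _ gp;
    split=> // _ q [].
- move: h; case: ifP => zb h.
    split=> // _ q [a sa <-]; exists r; split; first by split.
    by apply: (@Jump _ _ _ _ (inl z)) => //=;
      rewrite -?(body_eq Phi_wn (z := inl z) sa) // /home /= zb.
  by rewrite env_free' ?zb // in gp; move: h gp; case E: pl => //= _ gp;
    split=> // _ q [].
- move: h; case: ifP => zb h //.
  by rewrite env_free' ?zb // in gp; move: h gp; case E: pl => //= _ gp;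
    split=> // _ q [].
- case E: pl gp => /= gp; split=> // _; case: gp.
  exact: (@sub_down_up F setT g).
- have da : good pl (interp (env r) a) (ObjPos g a) ->
      advance r (ObjPos g (And a b)) (ObjPos g a).
    move=> ?; apply: descend_advance => //=; first by case.
      by right; left; apply: subformula_refl.
    by rewrite ltnS leq_addr.
  have db : good pl (interp (env r) b) (ObjPos g b) ->
      advance r (ObjPos g (And a b)) (ObjPos g b).
    move=> ?; apply: descend_advance => //=; first by case.
      by right; right; apply: subformula_refl.
    by rewrite ltnS leq_addl.
  move: (interp (env r) a) (interp (env r) b) gp da db => ca cb.
  case E: pl => /= gp da db; split=> // _.
    by case: gp => ga gb q [->|->]; [apply: da|apply: db].
  have [ga|na] := pselect (extent ca g); last first.
    by exists (ObjPos g a); [left|apply: da].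
  by exists (ObjPos g b); [right|apply: db => gb; apply: gp].
- have d m : good pl (interp (env r) a) (FeatPos m a) ->
      advance r (ObjPos g (Box a)) (FeatPos m a).
    by move=> ?; apply: descend_advance => //=; [case|right; apply: subformula_refl].
  case E: pl gp d => /= gp d; split=> // _.
    by move=> q [m nR <-]; apply: d => /gp.
  move/existsNP: gp => [m /not_implyP[am nR]].
  by exists (FeatPos m a); [exists m|apply: d; apply].
- split=> // _ q ->.
  exact: (@unfold_advance r (ObjPos g (Nu v a)) (ObjPos g a) (inl v)).
- by rewrite env_atom in gp; move: h gp; case E: pl => //= _ gp;
    split=> // _ q [].
- move: h; case: ifP => zb h //.
  by rewrite env_free' ?zb // in gp; move: h gp; case E: pl => //= _ gp;
    split=> // _ q [].
- move: h; case: ifP => zb h.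
    split=> // _ q [a sa <-]; exists r; split; first by split.
    by apply: (@Jump _ _ _ _ (inr z)) => //=;
      rewrite -?(body_eq Phi_wn (z := inr z) sa) // /home /= zb.
  by rewrite env_free' ?zb // in gp; move: h gp; case E: pl => //= _ gp;
    split=> // _ q [].
- case E: pl gp => /= gp; split=> // _; case: gp.
  exact: (@sub_up_down F setT m).
- have da : good pl (interp (env r) a) (FeatPos m a) ->
      advance r (FeatPos m (Or a b)) (FeatPos m a).
    move=> ?; apply: descend_advance => //=; first by case.
      by right; left; apply: subformula_refl.
    by rewrite ltnS leq_addr.
  have db : good pl (interp (env r) b) (FeatPos m b) ->
      advance r (FeatPos m (Or a b)) (FeatPos m b).
    move=> ?; apply: descend_advance => //=; first by case.
      by right; right; apply: subformula_refl.
    by rewrite ltnS leq_addl.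
  move: (interp (env r) a) (interp (env r) b) gp da db => ca cb.
  case E: pl => /= gp da db; split=> // _; last first.
    by move/contrapT: gp => [ga gb] q [->|->]; [apply: da|apply: db]; apply.
  have [ga|na] := pselect (intent ca m); last first.
    by exists (FeatPos m a); [left|apply: da].
  by exists (FeatPos m b); [right|apply: db => gb; apply: gp].
- have d g : good pl (interp (env r) a) (ObjPos g a) ->
      advance r (FeatPos m (Dia a)) (ObjPos g a).
    by move=> ?; apply: descend_advance => //=; [case|right; apply: subformula_refl].
  case E: pl gp d => /= gp d; split=> // _; last first.
    by move=> q [g nR <-]; apply: d => /(contrapT gp).
  move/existsNP: gp => [g /not_implyP[am nR]].
  by exists (ObjPos g a); [exists g|apply: d].
- split=> // _ q ->.
  exact: (@unfold_advance r (FeatPos m (Mu v a)) (FeatPos m a) (inr v)).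
Qed.

Lemma advance_exists r p : good_state r p -> owner Phi p = Some pl ->
  exists2 q, moves V Phi p q & advance r p q.
Proof.
move=> ip op; case hp : (home p); first exact: (advance_at_home ip hp).1.
move/negbT in hp; have := flip_owner_moves hp; rewrite op => -[epl].
have [q fq gq] := (flip_good ip.2).1 epl.
by exists q; [apply/(flip_moves q ip hp)|apply: switch_advance].
Qed.

Lemma advance_all r p q : good_state r p -> owner Phi p <> Some pl ->
  moves V Phi p q -> advance r p q.
Proof.
move=> ip op mq; case hp : (home p); first exact: ((advance_at_home ip hp).2 op).
move/negbT in hp; have fq := (flip_moves q ip hp).2 mq.
apply: switch_advance => //; apply: (flip_good ip.2).2 => // epl.
by apply: op; rewrite (flip_owner_moves hp) epl.
Qed.

End Progress.

(** * Eventuality and descent along the natural numbers *)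

Lemma eventually_all (T : eqType) (s : seq T) (Q : nat -> T -> Prop) :
  (forall z, z \in s -> exists N, forall k, N <= k -> Q k z) ->
  exists N, forall z, z \in s -> forall k, N <= k -> Q k z.
Proof.
elim: s => [|z s IH] H; first by exists 0.
have [|N1 H1] := IH; first by move=> w ws; apply: H; rewrite inE ws orbT.
have [N2 H2] := H z (mem_head _ _).
exists (maxn N1 N2) => w; rewrite inE => /orP[/eqP->|ws] k; rewrite geq_max.
  by case/andP=> _; apply: H2.
by case/andP=> k1 _; apply: H1.
Qed.

Lemma no_infinite_decrease (w : nat -> nat) N :
  ~ (forall k, N <= k -> w k.+1 < w k).
Proof.
move=> H; have {}H n : w (N + n) + n <= w N.
  elim: n => [|n IH]; first by rewrite !addn0.
  rewrite addnS addnS -addSn; apply: leq_trans IH.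
  by rewrite leq_add2r; apply: H; rewrite leq_addr.
by have := leq_trans (leq_addl _ _) (H (w N).+1); rewrite ltnn.
Qed.

(** * Maximal variables of infinite plays *)

Section Plays.
Context {At : countType} {X Y : eqType} {F : enriched_context}.
Variables (V : valuation At X Y F) (Phi : formula At X Y).
Hypothesis Phi_wn : well_named Phi.
Local Notation pos := (@position At X Y F).
Local Notation body := (body Phi).
Implicit Types (p q : pos) (z w : var X Y) (u : nat -> pos).

Lemma moves_form p q : moves V Phi p q ->
  subformula (form_of q) (form_of p) \/
  exists z, [/\ z \in bv Phi, form_of p = Var z & form_of q = bind z (body z)].
Proof.
have fl p' : flips p' q -> subformula (form_of q) (form_of p').
  by move/flip_form=> [-> _]; apply: subformula_refl.
have rf := @subformula_refl At X Y.
case: p => [g|m] [c|[z|z]|||b b'|b b'|b|b|v b|v b] mq;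
  try (by left; apply: fl); rewrite /= in mq.
- by left; apply: fl; case: mq.
- move: mq; case: ifP => zb; last by case=> _ ?; left; apply: fl.
  move=> [a sa <-]; right; exists (inl z).
  by rewrite -(body_eq Phi_wn (z := inl z) sa).
- by move: mq; case: ifP => zb; [|case=> _] => ?; left; apply: fl.
- by left; case: mq => ->; right; [left|right]; apply: rf.
- by case: mq => m _ <-; left; right; apply: rf.
- by rewrite mq; left; right; apply: rf.
- by left; apply: fl; case: mq.
- by move: mq; case: ifP => zb; [|case=> _] => ?; left; apply: fl.
- move: mq; case: ifP => zb; last by case=> _ ?; left; apply: fl.
  move=> [a sa <-]; right; exists (inr z).
  by rewrite -(body_eq Phi_wn (z := inr z) sa).
- by left; case: mq => ->; right; [left|right]; apply: rf.
- by case: mq => g _ <-; left; right; apply: rf.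
- by rewrite mq; left; right; apply: rf.
Qed.

(** Two moves are allowed for because a play on the wrong side of a variable first changes sides. *)
Lemma moves_var p q q' z : z \in bv Phi -> form_of p = Var z ->
  moves V Phi p q -> moves V Phi q q' ->
  form_of q = bind z (body z) \/ form_of q' = bind z (body z).
Proof.
case: p => [g|m] _ zb /= ->; case: z zb => z zb /=; rewrite zb.
- by move=> [a sa <-] _; left; rewrite -(body_eq Phi_wn (z := inl z) sa).
- move=> [m _ <-] /=; rewrite zb => -[a sa <-].
  by right; rewrite -(body_eq Phi_wn (z := inr z) sa).
- move=> [g _ <-] /=; rewrite zb => -[a sa <-].
  by right; rewrite -(body_eq Phi_wn (z := inl z) sa).
- by move=> [a sa <-] _; left; rewrite -(body_eq Phi_wn (z := inr z) sa).
Qed.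

Section Play.
Variable u : nat -> pos.
Hypothesis u_moves : forall n, moves V Phi (u n) (u n.+1).

Lemma inf_often_bind z : z \in bv Phi -> inf_often u z ->
  forall n, exists2 k, n <= k & form_of (u k) = bind z (body z).
Proof.
move=> zb iz n; have [k nk ek] := iz n.
have [e|e] := moves_var zb ek (u_moves k) (u_moves k.+1).
  by exists k.+1 => //; apply: leqW.
by exists k.+2 => //; apply/leqW/leqW.
Qed.

(* A play leaves [bind z (body z)] only through a free variable of it. *)
Lemma max_inf_var_stay z : max_inf_var Phi u z ->
  exists N, forall k, N <= k -> subformula (form_of (u k)) (bind z (body z)).
Proof.
move=> [zb iz zmax]; set B := bind z (body z).
(* By maximality of [z], the bound variables free in [B] occur only finitely often; [N] lies beyond
   all these occurrences. *)
have [|N HN] := @eventually_all _ (fv B)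
    (fun k w => w \in bv Phi -> form_of (u k) <> Var w).
  move=> w; rewrite fv_bind mem_filter => /andP[wz wf].
  have [wb|wb] := boolP (w \in bv Phi); last by exists 0 => k _ h; case/negP: wb.
  apply: contrapT => H; move/eqP: wz; apply; apply: zmax => //.
    move=> n; apply: contrapT => nk; apply: H; exists n => k nk' _ ek.
    by apply: nk; exists k.
  by exists (body z) => //; apply: bodyP.
have [K NK eK] := inf_often_bind zb iz N.
exists K => k /subnKC <-; elim: (k - K) => [|d IH].
  by rewrite addn0 eK; apply: subformula_refl.
rewrite addnS; case: (moves_form (u_moves (K + d))) => [s|[w [wb ew ew']]].
  exact: subformula_trans s IH.
rewrite ew'; have wf : w \in fv (form_of (u (K + d))) by rewrite ew inE.
have [wB|/bv_bindP[a sa]] := sub_fv IH wf.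
  by case: (HN w wB (K + d)) => //; apply: leq_trans (leq_addr _ _).
rewrite -(body_eq Phi_wn (subformula_trans sa (bodyP zb))).
exact: sa.
Qed.

(** Both binders are visited infinitely often, so each is a subformula of the other, and they agree
    by size. *)
Lemma max_inf_var_unique z z' :
  max_inf_var Phi u z -> max_inf_var Phi u z' -> z = z'.
Proof.
move=> mz mz'.
have [N HN] := max_inf_var_stay mz; have [N' HN'] := max_inf_var_stay mz'.
case: mz mz' => zb iz _ [zb' iz' _].
have [k Nk ek] := inf_often_bind zb iz N'.
have [k' Nk' ek'] := inf_often_bind zb' iz' N.
have := HN _ Nk'; have := HN' _ Nk; rewrite ek ek'.
move=> /subformula_size[/bind_inj[]//|lt] /subformula_size_le.
by rewrite leqNgt lt.
Qed.

(** Among the bound variables occurring infinitely often, take one of least [idx]: depending on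
    another would give a smaller index. *)
Lemma max_inf_var_exists :
  (forall n, exists k z, [/\ n <= k, z \in bv Phi & form_of (u k) = Var z]) ->
  exists z, max_inf_var Phi u z.
Proof.
move=> H.
pose P i := `[< exists z, [/\ z \in bv Phi, inf_often u z & idx Phi z = i] >].
have exP : exists i, P i.
  apply: contrapT => nP.
  have [|N HN] := @eventually_all _ (bv Phi) (fun k w => form_of (u k) <> Var w).
    move=> z zb; apply: contrapT => Hz; apply: nP; exists (idx Phi z).
    apply/asboolP; exists z; split=> // n; apply: contrapT => nk; apply: Hz.
    by exists n => k nk' ek; apply: nk; exists k.
  by have [k [z [Nk zb ek]]] := H N; apply: (HN z zb k).
case: (ex_minnP exP) => _ /asboolP[z [zb iz <-]] zmin.
exists z; split=> // w wb iw [a sa wa].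
apply/eqP/negPn/negP => wz.
have Pw : P (idx Phi w) by apply/asboolP; exists w.
have := zmin _ Pw; rewrite leqNgt (fv_body Phi_wn zb _ wz wb) //.
by rewrite -(body_eq Phi_wn sa).
Qed.

End Play.
End Plays.

(** * Infinite runs through good positions are won *)

Section Runs.
Context {At : countType} {X Y : eqType} {F : enriched_context}.
Variables (V : valuation At X Y F) (Phi : formula At X Y).
Hypothesis Phi_wn : well_named Phi.
Variable pl : player.
Local Notation pos := (@position At X Y F).
Local Notation rank := (var X Y -> tree (concept F)).
Variables (u : nat -> pos) (r : nat -> rank).
Hypothesis u_moves : forall n, moves V Phi (u n) (u n.+1).
Hypothesis u_step : forall n, step Phi pl (r n) (u n) (r n.+1) (u n.+1).

(** Size counts double so that a descent outweighs the possible loss of home, while a switch gains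
    one. Only [Jump] can raise the weight, which excludes endless alternation at an atom or a free
    variable. *)
Definition weight (p : pos) : nat := (fsize (form_of p)).*2 + ~~ home Phi pl p.

Lemma run_bound_var n :
  exists k z, [/\ n <= k, z \in bv Phi & form_of (u k) = Var z].
Proof.
apply: contrapT => H; apply: (@no_infinite_decrease (weight \o u) n) => k nk /=.
rewrite /weight; case: (u_step k) => [e _ h h'|z zb e|lt _ _ _].
- by rewrite e h h' ltn_add2l.
- by case: H; exists k, z.
- apply: leq_trans (leq_addr _ _).
  apply: (@leq_trans (fsize (form_of (u k.+1))).+1.*2); last by rewrite leq_double.
  by rewrite doubleS ltnS -[leqRHS]addn1 leq_add2l leq_b1.
Qed.

Lemma fsize_gt0 (psi : formula At X Y) : 0 < fsize psi.
Proof. by case: psi. Qed.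

(** An occurrence of [z] leads, after at most one switch, to a jump to its binder. That position is
    at home and not a variable, so the next step is a [Descend], which lowers the rank. *)
Lemma run_unfold n z : z \in bv Phi -> inf_often u z -> losing pl z ->
  exists2 j, n <= j & child (r j.+1 z) (r j z).
Proof.
move=> zb iz lz; have [k nk ek] := iz n.
have jump j : n <= j -> form_of (u j) = Var z -> home Phi pl (u j) ->
    exists2 j, n <= j & child (r j.+1 z) (r j z).
  move=> nj ej hj; case: (u_step j) => [|w _ ew ew' _ _ hj'|].
  - by move=> _ _; rewrite hj.
  - move: ew; rewrite ej => -[ezw]; rewrite -{}ezw in ew'.
    exists j.+1; first exact: leqW.
    case: (u_step j.+1) => [_ _|w' _ e|_ _ c _]; first by rewrite hj'.
      by move: ew'; rewrite e; case: (z).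
    exact: c ew' lz.
  - by rewrite ej ltnS leqNgt fsize_gt0.
have [hk|hk] := boolP (home Phi pl (u k)); first exact: (jump k).
case: (u_step k) => [e _ _ h|w _ _ _ _|]; last by rewrite ek ltnS leqNgt fsize_gt0.
  by apply: (jump k.+1); [apply: leqW|rewrite e|].
by rewrite (negbTE hk).
Qed.

Lemma run_wins : wins_infinite Phi pl u.
Proof.
have [z mz] := max_inf_var_exists Phi_wn run_bound_var.
exists z => //; have [N HN] := max_inf_var_stay Phi_wn u_moves mz.
case: (mz) => zb iz _.
have [lz|] := boolP (losing pl z); last by case: (pl) (z) => [] [].
exfalso; apply: (@no_infinite_descent _ (fun k => r k z) N) => k Nk; last first.
  exact: run_unfold.
case: (u_step k) => [_ -> _ _|w _ _ _ -> _ _|lt _ c same]; [by left|by left|].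
have [[a ea]|na] := pselect (exists a, form_of (u k) = bind z a).
  by right; apply: c ea lz.
(* Only a descent into the binder of [z] could reset its rank, but from [N] on nothing larger than
   that binder is visited. *)
left; apply: same => a ea; first by apply: na; exists a.
have sa : subformula (bind z a) Phi.
  by rewrite -ea; apply: subformula_trans (HN _ (leqW Nk)) (bodyP zb).
have := leq_trans lt (subformula_size_le (HN _ Nk)).
by rewrite ea (body_eq Phi_wn sa) ltnn.
Qed.

End Runs.

(** * From local progress to strategies, and their exclusivity *)

Section Strategies.
Context {At : countType} {X Y : eqType} {F : enriched_context}.
Variables (V : valuation At X Y F) (Phi : formula At X Y).
Local Notation pos := (@position At X Y F).
Implicit Types (p q : pos) (s : seq pos).

Lemma partial_play_rcons p0 s q :
  partial_play V Phi p0 (rcons s q) <->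
  partial_play V Phi p0 s /\ moves V Phi (last p0 s) q.
Proof.
have nthS i : i < size (p0 :: s) -> nth p0 (p0 :: rcons s q) i = nth p0 (p0 :: s) i.
  by move=> lt; rewrite -rcons_cons nth_rcons lt.
have nthl : nth p0 (p0 :: rcons s q) (size s).+1 = q.
  by rewrite /= nth_rcons ltnn eqxx.
have lastE : last p0 s = nth p0 (p0 :: s) (size s) by rewrite (nth_last p0 (p0 :: s)).
split=> [H|[H m] i]; last first.
  rewrite size_rcons ltnS leq_eqVlt => /orP[/eqP->|lt].
    by rewrite nthl nthS // -lastE.
  by have lt' := leqW lt; rewrite !nthS //; apply: H.
split=> [i lt|].
  have := H i; rewrite size_rcons => /(_ (leqW lt)).
  by have lt' := leqW lt; rewrite !nthS.
have := H (size s); rewrite size_rcons => /(_ (leqnn _)).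
by rewrite nthl nthS // -lastE.
Qed.

Lemma follows_rcons pl sigma p0 s q :
  follows Phi pl sigma p0 (rcons s q) <->
  follows Phi pl sigma p0 s /\ (owner Phi (last p0 s) = Some pl -> q = sigma (p0 :: s)).
Proof.
have nthS i : i < size (p0 :: s) -> nth p0 (p0 :: rcons s q) i = nth p0 (p0 :: s) i.
  by move=> lt; rewrite -rcons_cons nth_rcons lt.
have nthl : nth p0 (p0 :: rcons s q) (size s).+1 = q.
  by rewrite /= nth_rcons ltnn eqxx.
have takeS i : i < size (p0 :: s) -> take i.+1 (p0 :: rcons s q) = take i.+1 (p0 :: s).
  by move=> lt; rewrite -rcons_cons -cats1 takel_cat.
have lastE : last p0 s = nth p0 (p0 :: s) (size s) by rewrite (nth_last p0 (p0 :: s)).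
split=> [H|[H m] i]; last first.
  rewrite size_rcons ltnS leq_eqVlt => /orP[/eqP->|lt].
    by rewrite nthl nthS // takeS // -lastE => /m ->; rewrite take_oversize.
  by have lt' := leqW lt; rewrite !nthS ?takeS //; apply: H.
split=> [i lt|].
  have := H i; rewrite size_rcons => /(_ (leqW lt)).
  by have lt' := leqW lt; rewrite !nthS ?takeS.
have := H (size s); rewrite size_rcons => /(_ (leqnn _)).
by rewrite nthl nthS // takeS // -lastE take_oversize.
Qed.

Definition history (u : nat -> pos) n := [seq u i | i <- iota 1 n].

Lemma historyS u n : history u n.+1 = rcons (history u n) (u n.+1).
Proof. by rewrite /history -[n.+1 in LHS]addn1 (iotaD 1 n 1) map_cat cats1 add1n. Qed.

Lemma last_history u n : last (u 0) (history u n) = u n.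
Proof. by case: n => // n; rewrite historyS last_rcons. Qed.

Lemma infinite_play_moves u n :
  (forall n, partial_play V Phi (u 0) (history u n)) -> moves V Phi (u n) (u n.+1).
Proof.
by move=> /(_ n.+1); rewrite historyS => /partial_play_rcons[_]; rewrite last_history.
Qed.

Section FromStates.
Variables (pl : player) (K : Type) (pos_of : K -> pos).
Variables (good_state : K -> Prop) (stp : K -> K -> Prop).
Hypothesis best_ex : forall k, good_state k -> owner Phi (pos_of k) = Some pl ->
  exists k', [/\ good_state k', stp k k' & moves V Phi (pos_of k) (pos_of k')].
Hypothesis adv_ex : forall k q, good_state k -> owner Phi (pos_of k) <> Some pl ->
  moves V Phi (pos_of k) q -> exists k', [/\ good_state k', stp k k' & pos_of k' = q].
Hypothesis forced_ex : forall k, good_state k -> owner Phi (pos_of k) = None ->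
  moves V Phi (pos_of k) !=set0.
Hypothesis run_wins : forall ks : nat -> K, (forall n, good_state (ks n)) ->
  (forall n, stp (ks n) (ks n.+1)) ->
  (forall n, moves V Phi (pos_of (ks n)) (pos_of (ks n.+1))) ->
  wins_infinite Phi pl (pos_of \o ks).

(** A strategy sees positions but not the ranks hidden in states. The state is therefore recomputed
    from the play by folding a chosen successor [adv] along it. *)
Lemma strategy_of_states k0 : good_state k0 -> has_winning_strategy V Phi pl (pos_of k0).
Proof.
move=> i0.
have /choice[best bestP] k : exists q, good_state k -> owner Phi (pos_of k) = Some pl ->
    moves V Phi (pos_of k) q /\ exists k', [/\ good_state k', stp k k' & pos_of k' = q].
  have [[ik ok]|nk] := pselect (good_state k /\ owner Phi (pos_of k) = Some pl).
    have [k' [? ? ?]] := best_ex ik ok; exists (pos_of k') => _ _.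
    by split=> //; exists k'.
  by exists (pos_of k) => ? ?; case: nk.
have /choice[adv advP] (kq : K * pos) : exists k', good_state kq.1 ->
    moves V Phi (pos_of kq.1) kq.2 ->
    (owner Phi (pos_of kq.1) = Some pl -> kq.2 = best kq.1) ->
    [/\ good_state k', stp kq.1 k' & pos_of k' = kq.2].
  case: kq => k q /=.
  have [[ik mq oq]|nk] := pselect [/\ good_state k, moves V Phi (pos_of k) q &
      owner Phi (pos_of k) = Some pl -> q = best k]; last first.
    by exists k => ? ? ?; case: nk.
  have [ok|ok] := pselect (owner Phi (pos_of k) = Some pl).
    by have [_ [k' kP]] := bestP k ik ok; exists k'; rewrite oq.
  by have [k' kP] := adv_ex ik ok mq; exists k'.
pose run s := foldl (fun k q => adv (k, q)) k0 s.
have runS s q : run (rcons s q) = adv (run s, q) by rewrite /run foldl_rcons.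
set p0 := pos_of k0.
(* The fallback to an arbitrary legal move keeps [sigma] legal on partial plays that do not follow
   it. *)
have /choice[sigma sigmaP] (h : seq pos) : exists q,
    (moves V Phi (last p0 (behead h)) (best (run (behead h))) -> q = best (run (behead h)))
    /\ (moves V Phi (last p0 (behead h)) !=set0 -> moves V Phi (last p0 (behead h)) q).
  have [m|nm] := pselect (moves V Phi (last p0 (behead h)) (best (run (behead h)))).
    by exists (best (run (behead h))).
  have [[q mq]|ne] := pselect (moves V Phi (last p0 (behead h)) !=set0).
    by exists q.
  by exists p0.
have runP s : partial_play V Phi p0 s -> follows Phi pl sigma p0 s ->
    good_state (run s) /\ pos_of (run s) = last p0 s.
  elim/last_ind: s => [//|s q IH] /partial_play_rcons[ps mq] /follows_rcons[fs oq].
  have [ir er] := IH ps fs; rewrite -er in mq oq.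
  have [] := advP (run s, q) ir mq; last by rewrite runS last_rcons.
  move=> /= oe; rewrite (oq oe); have [m _] := bestP _ ir oe.
  by apply: (sigmaP (p0 :: s)).1; rewrite /= -er.
exists sigma; split.
- by move=> s _ _ ne; apply: (sigmaP (p0 :: s)).2.
- move=> s ps fs m0; have [ir er] := runP s ps fs.
  (* A dead end cannot be a forced position, nor belong to [pl], who would have the move [best]; so
     it belongs to the opponent. *)
  rewrite /wins_stuck -er; case E: (owner Phi (pos_of (run s))) => [pl'|]; last first.
    by have := forced_ex ir E; rewrite er m0 => -[].
  have [epl|npl] := pselect (pl' = pl); last by case: pl' pl npl {E} => [] [].
  rewrite epl in E; have [m _] := bestP _ ir E.
  by rewrite er m0 in m.
- move=> u u0 H; rewrite -u0 in H *.
  have rP n : good_state (run (history u n)) /\ pos_of (run (history u n)) = u n.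
    have [] := H n; rewrite u0 => ps fs.
    by rewrite -[in RHS](last_history u) u0; apply: runP.
  have um n : moves V Phi (u n) (u n.+1).
    by apply: infinite_play_moves => k; have [] := H k.
  suff : wins_infinite Phi pl (pos_of \o (run \o history u)).
    by congr wins_infinite; apply/funext => n; have [] := rP n.
  apply: run_wins => n /=; first by have [] := rP n.
    have [ir er] := rP n; rewrite historyS runS.
    have := um n; rewrite -er => mu.
    case: (advP (run (history u n), u n.+1) ir mu) => //= oe.
    have [_] := H n.+1; rewrite -/(history u n.+1) historyS => /follows_rcons[_].
    rewrite last_history -er => /(_ oe) ->.
    have [m _] := bestP _ ir oe.
    by apply: (sigmaP (u 0 :: history u n)).1; rewrite /= -u0 last_history -er.
  by have [_ ->] := rP n; have [_ ->] := rP n.+1.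
Qed.

End FromStates.

(** Let the two strategies play each other. A dead end would be won by both players, so the play is
    infinite, and its unique maximal variable would have to favour both. *)
Lemma winning_exclusive p0 : well_named Phi ->
  has_winning_strategy V Phi Eloise p0 -> has_winning_strategy V Phi Abelard p0 -> False.
Proof.
move=> wn [sigma [sl ss si]] [tau [tl ts ti]].
have /choice[nxt nxtP] (s : seq pos) : exists q,
    [/\ partial_play V Phi p0 s -> moves V Phi (last p0 s) !=set0 ->
          moves V Phi (last p0 s) q,
        owner Phi (last p0 s) = Some Eloise -> q = sigma (p0 :: s) &
        owner Phi (last p0 s) = Some Abelard -> q = tau (p0 :: s)].
  case E: (owner Phi (last p0 s)) => [[]|].
  - by exists (sigma (p0 :: s)); split=> // ps ne; apply: sl.
  - by exists (tau (p0 :: s)); split=> // ps ne; apply: tl.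
  - have [[q mq]|ne] := pselect (moves V Phi (last p0 s) !=set0).
      by exists q.
    by exists p0.
pose hist := fix hist n := if n is n.+1 then rcons (hist n) (nxt (hist n)) else [::].
pose u n := last p0 (hist n).
have histE n : hist n = history u n.
  by elim: n => [//|n IH]; rewrite historyS -IH /u /= last_rcons.
have P n : [/\ partial_play V Phi p0 (hist n), follows Phi Eloise sigma p0 (hist n)
    & follows Phi Abelard tau p0 (hist n)].
  elim: n => [//|n [pp fs ft]] /=.
  have ne : moves V Phi (last p0 (hist n)) !=set0.
    apply/set0P/eqP => m0.
    by have := ss _ pp fs m0; have := ts _ pp ft m0; rewrite /wins_stuck => ->.
  have [m es et] := nxtP (hist n).
  split; first by apply/partial_play_rcons; split=> //; apply: m.
    by apply/follows_rcons.
  by apply/follows_rcons.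
have u0 : u 0 = p0 by [].
have um n : moves V Phi (u n) (u n.+1).
  by apply: infinite_play_moves => k; rewrite u0 -histE; have [] := P k.
have [z mz ez] : wins_infinite Phi Eloise u.
  by apply: si => // n; rewrite -/(history u n) -histE; have [] := P n.
have [z' mz' ez'] : wins_infinite Phi Abelard u.
  by apply: ti => // n; rewrite -/(history u n) -histE; have [] := P n.
by move: ez ez'; rewrite (max_inf_var_unique wn um mz mz') => ->.
Qed.

End Strategies.

(** * Truth decides the winner *)

Section Adequacy.
Context {At : countType} {X Y : eqType} {F : enriched_context}.
Variables (V : valuation At X Y F) (Phi : formula At X Y).
Hypothesis Phi_wn : well_named Phi.
Local Notation pos := (@position At X Y F).

Lemma good_wins pl (p : pos) : form_of p = Phi ->
  good pl (interp V Phi) p -> has_winning_strategy V Phi pl p.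
Proof.
move=> ep gp.
(* The initial ranks are arbitrary, since no free variable of [Phi] is bound in it; [enter_good]
   adjusts them if [Phi] is itself a binder. *)
pose r0 : var X Y -> tree (concept F) := fun _ => Leaf.
have g0 : good pl (interp (env V Phi pl r0) Phi) p.
  rewrite (_ : interp _ _ = interp V Phi) //; apply: interp_ext.
    exact: envl_atom.
  by move=> z /Phi_wn.2; apply: env_free.
have [r [gr _]] := enter_good Phi_wn (subformula_refl Phi) g0.
pose K : Type := (pos * (var X Y -> tree (concept F)))%type.
have := @strategy_of_states _ _ _ _ V Phi pl K (fun k => k.1)
  (fun k => good_state V Phi pl k.2 k.1)
  (fun k k' => step Phi pl k.2 k.1 k'.2 k'.1) _ _ _ _ (p, r).
apply.
- move=> [q t] iq /= oq; have [q' mq [t' [iq' st]]] := advance_exists Phi_wn iq oq.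
  by exists (q', t').
- move=> [q t] q' iq /= oq mq; have [t' [iq' st]] := advance_all Phi_wn iq oq mq.
  by exists (q', t').
- move=> [q t] [/= sq _] oq.
  case: q sq oq => [g|m] [c|[z|z]|||b b'|b b'|b|b|v b|v b] //=.
  + by case: ifP => // /bv_bindP[a sa] _ _; exists (ObjPos g (Nu z a)), a.
  + by exists (ObjPos g b).
  + by case: ifP => // /bv_bindP[a sa] _ _; exists (FeatPos m (Mu z a)), a.
  + by exists (FeatPos m b).
- move=> ks _ st um.
  exact: (@run_wins _ _ _ _ V Phi Phi_wn pl _ (fun n => (ks n).2)).
- by split=> /=; rewrite ep //; apply: subformula_refl.
Qed.

End Adequacy.

Theorem theorem6 (At : countType) (X Y : eqType) (F : enriched_context)
    (V : valuation At X Y F) (phi : formula At X Y) (phi_wn : well_named phi) :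
  (forall g : obj F,
     sat V g phi <-> has_winning_strategy V phi Eloise (ObjPos g phi)) /\
  (forall m : feat F,
     ~ cosat V m phi <-> has_winning_strategy V phi Eloise (FeatPos m phi)).
Proof.
have win pl := @good_wins _ _ _ _ V _ phi_wn pl.
split=> n; split=> [h|we]; first exact: (win Eloise).
(* If [phi] failed here, the position would be good for Abelard, who would win it too. *)
- apply: contrapT => ng; apply: (winning_exclusive phi_wn we).
  exact: (win Abelard).
- exact: (win Eloise).
- move=> cn; apply: (winning_exclusive phi_wn we).
  by apply: (win Abelard) => //= /(_ cn).
Qed.
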